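(* Assume that $M$ is nonsingular. Let $S,Q\in\mathbb{C}^{\nu\times\nu}$, $L\in\mathbb{C}^{p\times\nu}$, $R\in\mathbb{C}^{\nu\times q}$ with $(L,S)$ observable and $(Q,R)$ controllable. If $\sigma(S)\cap\Omega=\emptyset$ and $\sigma(Q)\cap\Omega=\emptyset$, then the equations $$M\Pi S^2+D\Pi S+K\Pi=BL,\qquad Q^2\Upsilon M+Q\Upsilon D+\Upsilon K=RC_0+QRC_1$$ have unique solutions $\Pi\in\mathbb{C}^{n\times\nu}$ and $\Upsilon\in\mathbb{C}^{\nu\times n}$, respectively. Moreover, these solutions characterize the right and left zeroth-order tangential moments of $W$ as follows: whenever $Sv_i=s_iv_i$ and $w_j^\ast Q=\mu_jw_j^\ast$, with $\ell_i:=Lv_i$ and $\rho_j^\ast:=w_j^\ast R$, $$W(s_i)\ell_i=(C_0\Pi+C_1\Pi S)v_i,\qquad \rho_j^\ast W(\mu_j)=w_j^\ast\Upsilon B.$$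
   Context: The system is the second-order system with $p$ inputs and $q$ outputs $M\ddot x+D\dot x+Kx=Bu$, $y=C_1\dot x+C_0x$, with $M,D,K\in\mathbb{R}^{n\times n}$, $B\in\mathbb{R}^{n\times p}$, $C_0,C_1\in\mathbb{R}^{q\times n}$, transfer matrix $W(s)=(C_1s+C_0)(Ms^2+Ds+K)^{-1}B$, and $\Omega=\{s\in\mathbb{C}:\det(Ms^2+Ds+K)=0\}$. The zeroth-order right and left tangential moments at $s_\star\in\mathbb{C}\setminus\Omega$ along $\ell\in\mathbb{C}^p$ and $\rho\in\mathbb{C}^q$ are $W(s_\star)\ell$ and $\rho^\ast W(s_\star)$. Here $v_i,w_j\in\mathbb{C}^\nu$ are nonzero, and $\ast$ denotes conjugate transpose. *)

(* Defs.v *)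
(* The reals are an arbitrary [R : realType], the complex numbers are [R[i]]. *)
From HB Require Import structures.
From mathcomp Require Import all_boot all_order all_algebra.
From mathcomp Require Import classical_sets reals complex.

Set Implicit Arguments.
Unset Strict Implicit.
Unset Printing Implicit Defensive.

Import Order.TTheory GRing.Theory Num.Theory.
Local Open Scope ring_scope.
Local Open Scope complex_scope.
Local Open Scope classical_set_scope.

Definition cplxmx (R : realType) (m n : nat) (A : 'M[R]_(m, n)) : 'M[R[i]]_(m, n) :=
  map_mx (real_complex R) A.

(* The matrix polynomial M s^2 + D s + K. *)
Definition quad_pencil (R : realType) (n : nat) (M D K : 'M[R]_n) (s : R[i]) :
    'M[R[i]]_n :=
  s ^+ 2 *: cplxmx M + s *: cplxmx D + cplxmx K.

Definition Omega (R : realType) (n : nat) (M D K : 'M[R]_n) : set R[i] :=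
  [set s | \det (quad_pencil M D K s) = 0].

(* Meaningful only for [s] outside [Omega M D K]: [invmx] returns its argument
   on a singular matrix. *)
Definition transfer_mx (R : realType) (n p q : nat) (M D K : 'M[R]_n)
    (B : 'M[R]_(n, p)) (C0 C1 : 'M[R]_(q, n)) (s : R[i]) : 'M[R[i]]_(q, p) :=
  (s *: cplxmx C1 + cplxmx C0) *m invmx (quad_pencil M D K s) *m cplxmx B.

(* [eigenvalue] is the library's notion (nontrivial row eigenspace); for a square
   matrix over a field it gives the same set as column eigenvectors. *)
Definition spectrum (R : realType) (nu : nat) (S : 'M[R[i]]_nu) : set R[i] :=
  [set s | eigenvalue S s].

(* Kalman rank condition on the stack of L, L S, ..., L S^(nu-1). *)
Definition observable (R : realType) (nu p : nat) (L : 'M[R[i]]_(p, nu))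
    (S : 'M[R[i]]_nu) : Prop :=
  \rank (\mxcol_(i < nu) (L *m S ^+ i)) = nu.

(* Kalman rank condition on [G, Q G, ..., Q^(nu-1) G]. *)
Definition controllable (R : realType) (nu q : nat) (Q : 'M[R[i]]_nu)
    (G : 'M[R[i]]_(nu, q)) : Prop :=
  \rank (\mxrow_(i < nu) (Q ^+ i *m G)) = nu.

Definition right_sylvester (R : realType) (n p nu : nat) (M D K : 'M[R]_n)
    (B : 'M[R]_(n, p)) (S : 'M[R[i]]_nu) (L : 'M[R[i]]_(p, nu))
    (Pi : 'M[R[i]]_(n, nu)) : Prop :=
  cplxmx M *m Pi *m S ^+ 2 + cplxmx D *m Pi *m S + cplxmx K *m Pi =
  cplxmx B *m L.

Definition left_sylvester (R : realType) (n q nu : nat) (M D K : 'M[R]_n)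
    (C0 C1 : 'M[R]_(q, n)) (Q : 'M[R[i]]_nu) (G : 'M[R[i]]_(nu, q))
    (Upsilon : 'M[R[i]]_(nu, n)) : Prop :=
  Q ^+ 2 *m Upsilon *m cplxmx M + Q *m Upsilon *m cplxmx D
    + Upsilon *m cplxmx K =
  G *m cplxmx C0 + Q *m G *m cplxmx C1.

(* Main.v *)
(* A polynomial matrix P(s) acts on X by substituting right multiplication by S
   for s, and this action is multiplicative.  For P(s) = M s^2 + D s + K it gives
   M X S^2 + D X S + K X, and since adj(P) P = P adj(P) = det P, the action of P
   is bijective as soon as (det P)(S) is invertible, that is, as soon as no
   eigenvalue of S is a root of det P.  The left equation is the transpose of a
   right one.  Applying the equations to eigenvectors yields the moments. *)
Require Import Defs.
From HB Require Import structures.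
From mathcomp Require Import all_boot all_order all_algebra.
From mathcomp Require Import classical_sets reals complex.

Set Implicit Arguments.
Unset Strict Implicit.
Unset Printing Implicit Defensive.

Import Order.TTheory GRing.Theory Num.Theory.
Local Open Scope ring_scope.
Local Open Scope complex_scope.
Local Open Scope sesquilinear_scope.
Local Open Scope classical_set_scope.

Section PolynomialAction.

Variables (F : closedFieldType) (nu' : nat).
Local Notation nu := nu'.+1.
Variable S : 'M[F]_nu.

(* The coefficients of [P] act on [X] from the left, its indeterminate acts as
   right multiplication by [S]. *)
Definition polymx_act m n (P : 'M[{poly F}]_(m, n)) (X : 'M[F]_(n, nu)) :
    'M[F]_(m, nu) :=
  \matrix_i \sum_j row j X *m horner_mx S (P i j).

(** The composed action multiplies by the values at [S] in reversed order; this is harmless because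
    [{poly F}] is commutative. *)
Lemma polymx_actM m n k (P : 'M_(m, n)) (P' : 'M_(n, k)) (X : 'M_(k, nu)) :
  polymx_act (P *m P') X = polymx_act P (polymx_act P' X).
Proof.
apply/row_matrixP => i; rewrite !rowK.
under eq_bigr => j _ do rewrite mxE rmorph_sum mulmx_sumr.
rewrite exchange_big /=; apply: eq_bigr => j _.
rewrite rowK mulmx_suml; apply: eq_bigr => l _.
by rewrite mulrC rmorphM /= -mulmxE mulmxA.
Qed.

Lemma polymx_actD m n (P P' : 'M_(m, n)) (X : 'M_(n, nu)) :
  polymx_act (P + P') X = polymx_act P X + polymx_act P' X.
Proof.
apply/row_matrixP => i; rewrite linearD /= !rowK -big_split /=.
by apply: eq_bigr => j _; rewrite mxE rmorphD /= mulmxDr.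
Qed.

Lemma polymx_act_scalar n (d : {poly F}) (X : 'M_(n, nu)) :
  polymx_act d%:M X = X *m horner_mx S d.
Proof.
apply/row_matrixP => i; rewrite rowK (bigD1 i) //= mxE eqxx row_mul big1 ?addr0 //.
by move=> j ji; rewrite mxE eq_sym (negPf ji) mulr0n rmorph0 mulmx0.
Qed.

Lemma polymx_actC m n (A : 'M_(m, n)) (X : 'M_(n, nu)) :
  polymx_act (map_mx polyC A) X = A *m X.
Proof.
apply/row_matrixP => i; rewrite rowK row_mul mulmx_sum_row.
by apply: eq_bigr => j _; rewrite !mxE horner_mx_C mul_mx_scalar.
Qed.

Lemma polymx_actXn m n k (A : 'M_(m, n)) (X : 'M_(n, nu)) :
  polymx_act ('X^k *: map_mx polyC A) X = A *m X *m S ^+ k.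
Proof.
rewrite -mul_scalar_mx polymx_actM polymx_act_scalar polymx_actC.
by rewrite rmorphXn /= horner_mx_X.
Qed.

(* With [d := \det P] coprime to the characteristic polynomial of [S], a Bezout
   coefficient [u] makes [d * u] act as the identity, by Cayley-Hamilton; hence
   [u *: \adj P] acts as an inverse of [P]. *)
Lemma polymx_act_bij n (P : 'M[{poly F}]_n) :
    (forall s, root (char_poly S) s -> ~~ root (\det P) s) ->
  bijective (polymx_act P).
Proof.
move=> rootP.
have /Bezout_eq1_coprimepP[[u v] /= uv1] : coprimep (\det P) (char_poly S).
  rewrite coprimep_sym.
  by apply/Pdiv.ClosedField.coprimepP => s; apply: rootP.
have actK (X : 'M_(n, nu)) : polymx_act (u * \det P)%:M X = X.
  have /(congr1 (horner_mx S)) := uv1.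
  rewrite rmorphD /= (rmorphM _ v) /= Cayley_Hamilton mulr0 addr0.
  by rewrite rmorph1 polymx_act_scalar => ->; rewrite mulmx1.
exists (polymx_act (u%:M *m \adj P)) => X.
  by rewrite -polymx_actM -mulmxA mul_adj_mx -scalar_mxM actK.
by rewrite -polymx_actM mulmxA scalar_mxC -mulmxA mul_mx_adj -scalar_mxM actK.
Qed.

End PolynomialAction.

Lemma quadratic_sylvester_unique (F : closedFieldType) (n nu : nat)
    (M D K : 'M[F]_n) (S : 'M[F]_nu) (N : 'M[F]_(n, nu)) :
    (forall s, eigenvalue S s ->
      \det (s ^+ 2 *: M + s *: D + K) != 0) ->
  exists! X : 'M[F]_(n, nu), M *m X *m S ^+ 2 + D *m X *m S + K *m X = N.
Proof.
(* [horner_mx] needs a matrix ring of positive size; for [nu = 0] the unknown is an empty matrix. *)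
case: nu S N => [|nu] S N detP.
  by exists 0; split=> [|X _]; apply/matrixP => i [].
(* The explicit powers ['X^1] and ['X^0] let [polymx_actXn] treat all three terms alike. *)
pose P : 'M[{poly F}]_n := 'X^2 *: map_mx polyC M + 'X^1 *: map_mx polyC D
  + 'X^0 *: map_mx polyC K.
have actE X : polymx_act S P X = M *m X *m S ^+ 2 + D *m X *m S + K *m X.
  by rewrite !polymx_actD !polymx_actXn expr1 mulmx1.
have [|g actK gK] := @polymx_act_bij F nu S n P.
  move=> s; rewrite -eigenvalue_root_char => /detP; apply: contra => /rootP.
  (* Evaluation at [s] is a ring morphism, so it commutes with the determinant. *)
  rewrite (_ : (\det P).[s] = \det (map_mx (horner_eval s) P)); last first.
    by rewrite det_map_mx.
  move=> <-; apply/eqP; congr (\det _).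
  by apply/matrixP => i j; rewrite !mxE /horner_eval !hornerE.
exists (g N); split=> [|X]; first by rewrite -actE gK.
by rewrite -actE => <-; rewrite actK.
Qed.

(** Transposition preserves the characteristic polynomial. This serves both the transposed left
    equation and the passage from column to row eigenvectors. *)
Lemma eigenvalue_trmx (F : fieldType) (n : nat) (A : 'M[F]_n) (a : F) :
  eigenvalue A^T a = eigenvalue A a.
Proof.
rewrite !eigenvalue_root_char /char_poly /char_poly_mx.
by rewrite -[in RHS]det_tr linearB /= tr_scalar_mx map_trmx.
Qed.

Lemma eigenvalue_quad_pencil_unitmx (R : realType) (n nu : nat) (M D K : 'M[R]_n)
    (S : 'M[R[i]]_nu) (s : R[i]) :
    spectrum S `&` Omega M D K = set0 -> eigenvalue S s ->
  quad_pencil M D K s \in unitmx.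
Proof.
move=> S_Omega eigs; rewrite unitmxE unitfE; apply/eqP => det0.
by have : (spectrum S `&` Omega M D K) s by []; rewrite S_Omega.
Qed.

Theorem theorem7 (R : realType) (n p q nu : nat)
    (M D K : 'M[R]_n) (B : 'M[R]_(n, p)) (C0 C1 : 'M[R]_(q, n))
    (S Q : 'M[R[i]]_nu) (L : 'M[R[i]]_(p, nu)) (G : 'M[R[i]]_(nu, q))
    (M_nonsingular : M \in unitmx)
    (LS_observable : observable L S)
    (QG_controllable : controllable Q G)
    (S_Omega : spectrum S `&` Omega M D K = set0)
    (Q_Omega : spectrum Q `&` Omega M D K = set0) :
  [/\ exists! Pi : 'M[R[i]]_(n, nu), right_sylvester M D K B S L Pi,
      exists! Upsilon : 'M[R[i]]_(nu, n),
        left_sylvester M D K C0 C1 Q G Upsilon,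
      forall Pi : 'M[R[i]]_(n, nu), right_sylvester M D K B S L Pi ->
      forall (s : R[i]) (v : 'cV[R[i]]_nu), v != 0 -> S *m v = s *: v ->
      forall l : 'cV[R[i]]_p, l = L *m v ->
        transfer_mx M D K B C0 C1 s *m l =
        (cplxmx C0 *m Pi + cplxmx C1 *m Pi *m S) *m v
    & forall Upsilon : 'M[R[i]]_(nu, n),
        left_sylvester M D K C0 C1 Q G Upsilon ->
      forall (mu : R[i]) (w : 'cV[R[i]]_nu), w != 0 ->
        w^t* *m Q = mu *: w^t* ->
      forall rho : 'cV[R[i]]_q, rho^t* = w^t* *m G ->
        rho^t* *m transfer_mx M D K B C0 C1 mu =
        w^t* *m Upsilon *m cplxmx B].
Proof.
have SP s := eigenvalue_quad_pencil_unitmx (s := s) S_Omega.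
have QP s := eigenvalue_quad_pencil_unitmx (s := s) Q_Omega.
split.
- apply: quadratic_sylvester_unique => s /SP.
  by rewrite unitmxE unitfE.
(* Transposing the left equation puts the unknown [Y^T] between the transposed coefficients and
   powers of [Q^T]. *)
- have [|X [XE Xuniq]] := @quadratic_sylvester_unique _ n nu (cplxmx M)^T
    (cplxmx D)^T (cplxmx K)^T Q^T (G *m cplxmx C0 + Q *m G *m cplxmx C1)^T.
    move=> s; rewrite eigenvalue_trmx => /QP.
    by rewrite unitmxE unitfE -det_tr !linearD !linearZ.
  have trE (Y : 'M_(nu, n)) : left_sylvester M D K C0 C1 Q G Y <->
      (cplxmx M)^T *m Y^T *m Q^T ^+ 2 + (cplxmx D)^T *m Y^T *m Q^T
      + (cplxmx K)^T *m Y^T = (G *m cplxmx C0 + Q *m G *m cplxmx C1)^T.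
    rewrite /left_sylvester !expr2 -!mulmxE -!trmx_mul -!linearD /= !mulmxA.
    by split=> [->|/trmx_inj].
  exists X^T; split=> [|Y /trE/Xuniq ->]; last by rewrite trmxK.
  by apply/trE; rewrite trmxK.
- move=> Pi PiE s v v0 Sv _ ->.
  have eigs : eigenvalue S s.
    rewrite -eigenvalue_trmx; apply/eigenvalueP; exists v^T.
      by rewrite -trmx_mul Sv linearZ.
    by rewrite trmx_eq0.
  (* On [v] each factor [S] becomes [s]; inverting the pencil then expresses [Pi *m v] through
     [B *m L *m v]. *)
  have PPi : quad_pencil M D K s *m (Pi *m v) = cplxmx B *m L *m v.
    rewrite -PiE !mulmxDl (expr2 S) -mulmxE -!mulmxA.
    by rewrite !Sv -!scalemxAr !Sv -!scalemxAr -!scalemxAl expr2 scalerA.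
  rewrite /transfer_mx -!mulmxA (mulmxA (cplxmx B)) -PPi.
  rewrite (mulKmx (SP s eigs)) !mulmxDl -!mulmxA Sv -!scalemxAr -scalemxAl.
  exact: addrC.
- move=> Ups UpsE mu w w0 wQ rho ->.
  have eigmu : eigenvalue Q mu.
    apply/eigenvalueP; exists (w^t*) => //.
    by rewrite map_mx_eq0 trmx_eq0.
  (* Multiplying by [w^t*] on the left turns each [Q] into [mu], and the right side into the output
     factor of the transfer matrix. *)
  have UpsP : w^t* *m Ups *m quad_pencil M D K mu =
      w^t* *m G *m (mu *: cplxmx C1 + cplxmx C0).
    transitivity (w^t* *m (G *m cplxmx C0 + Q *m G *m cplxmx C1)).
      rewrite -UpsE !mulmxDr (expr2 Q) -mulmxE !mulmxA !wQ -!scalemxAl !wQ.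
      by rewrite -!scalemxAl -!scalemxAr expr2 scalerA.
    by rewrite !mulmxDr !mulmxA wQ -!scalemxAl -scalemxAr addrC.
  by rewrite /transfer_mx !mulmxA -UpsP (mulmxK (QP mu eigmu)).
Qed.
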